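(* Let $n,k$ be positive integers with $4\le 2k\le n$, and let $\mathcal{G}\subseteq 2^{[n]}$ be a family of nonempty sets, each of size at most $k$. Then $\mathcal{F}(\mathcal{G})$ is intersecting if and only if $\mathcal{G}$ is strongly intersecting.
   Context: $[n]=\{1,\dots,n\}$; elements of a set are always listed in increasing order. For sets $A=\{a_1<\dots<a_r\}$ and $B=\{b_1<\dots<b_r\}$ of the same size, $A\le B$ means $a_i\le b_i$ for all $i$. For $A=\{a_1<\dots<a_r\}$ and $B=\{b_1<\dots<b_s\}$, $A\preceq B$ means $r\ge s$ and $a_i\le b_i$ for all $1\le i\le s$. For $\mathcal{G}\subseteq 2^{[n]}$, $$\mathcal{F}(\mathcal{G})=\Big\{A\in\binom{[n]}{k}: A\preceq G\text{ for some }G\in\mathcal{G}\Big\},$$ where $\binom{[n]}{k}$ is the family of all $k$-element subsets of $[n]$. A family $\mathcal{A}$ is intersecting if $A\cap B\ne\varnothing$ for all $A,B\in\mathcal{A}$. Two nonempty sets $G,H\subseteq[n]$ (not necessarily distinct) are strongly intersecting, written $G\sim_{si}H$, if $G'\cap H'\neq\varnothing$ for all subsets $G',H'\subseteq[n]$ with $G'\le G$ and $H'\le H$. A family $\mathcal{G}\subseteq 2^{[n]}$ is strongly intersecting if every pair of its members (including each member paired with itself) is strongly intersecting. *)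

(* Defs.v *)
From mathcomp Require Import all_boot.

Set Implicit Arguments.
Unset Strict Implicit.
Unset Printing Implicit Defensive.

(* The ground set [n] = {1, ..., n} is represented by 'I_n = {0, ..., n-1}.
   Everything below depends only on the order of the elements, so the shift
   by one is immaterial. *)

(* [enum] on 'I_n is increasing (see [sorted_elems]). *)
Definition elems n (A : {set 'I_n}) : seq nat := [seq val i | i <- enum A].

Lemma size_elems n (A : {set 'I_n}) : size (elems A) = #|A|.
Proof. by rewrite size_map -cardE. Qed.

Lemma mem_elems n (A : {set 'I_n}) (i : 'I_n) : (val i \in elems A) = (i \in A).
Proof. by rewrite mem_map ?mem_enum //; apply: val_inj. Qed.

Lemma sorted_elems n (A : {set 'I_n}) : sorted ltn (elems A).
Proof.
apply: (@subseq_sorted _ ltn ltn_trans _ (iota 0 n)); last exact: iota_ltn_sorted.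
rewrite /elems -val_enum_ord map_subseq // {1}/enum_mem.
by rewrite -enumT filter_subseq.
Qed.

(* The element a_(i+1) of A = {a_1 < ... < a_r}; the default value 0 is never
   reached below. *)
Definition nth_elem n (A : {set 'I_n}) (i : nat) : nat := nth 0 (elems A) i.

(* A <= B *)
Definition set_le n (A B : {set 'I_n}) : bool :=
  (#|A| == #|B|) && [forall i : 'I_#|B|, nth_elem A i <= nth_elem B i].

(* A \preceq B *)
Definition set_prec n (A B : {set 'I_n}) : bool :=
  (#|B| <= #|A|) && [forall i : 'I_#|B|, nth_elem A i <= nth_elem B i].

(* F(G) *)
Definition generated_family n (k : nat) (G : {set {set 'I_n}}) :
    {set {set 'I_n}} :=
  [set A : {set 'I_n} | (#|A| == k) && [exists B in G, set_prec A B]].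

Definition intersecting n (F : {set {set 'I_n}}) : bool :=
  [forall A in F, forall B in F, A :&: B != set0].

(* The relation is only meant for nonempty G and H; it is false when one of
   them is empty, since then G' (or H') can only be empty as well. *)
Definition strongly_intersect n (G H : {set 'I_n}) : bool :=
  [forall G' : {set 'I_n}, forall H' : {set 'I_n},
    set_le G' G ==> set_le H' H ==> (G' :&: H' != set0)].

Definition strongly_intersecting n (F : {set {set 'I_n}}) : bool :=
  [forall G in F, forall H in F, strongly_intersect G H].

(* Main.v *)
Require Import Defs.
From mathcomp Require Import all_boot.

(** Both implications rest on two facts. Enlarging a set can only decrease its
    i-th smallest element, so every superset of [G'] with [G' <= G] satisfies
    [A \preceq G]; conversely, [A \preceq G] says that the initial segment of
    [A] of size [#|G|] is [<= G]. Disjoint [G' <= G] and [H' <= H] of size at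
    most [k] extend to disjoint [k]-sets because [2 * k <= n]. *)

(** Deleting entries of an increasing sequence moves later, hence larger, entries forward. The bound
    [i < size s] keeps the default 0 from being read in [s], where the inequality could fail. *)
Lemma subseq_sorted_nth_leq (s t : seq nat) (i : nat) :
  sorted ltn t -> subseq s t -> i < size s -> nth 0 t i <= nth 0 s i.
Proof.
elim: t s i => [|y t IHt] [|x s] i //=.
rewrite (path_sortedE ltn_trans) => /andP[/allP y_lt t_sorted].
case: eqVneq => [-> st | _ xst]; first by case: i => [|i] //= /IHt ->.
(* Here [y] is deleted and all of [x :: s] lies in [t], above [y]; at later positions the tail [s]
   is still a subsequence of [t]. *)
case: i => [|i] lt_i /=; first by rewrite ltnW ?y_lt ?(mem_subseq xst) ?mem_head.
exact: IHt (cons_subseq xst) lt_i.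
Qed.

Lemma elems_subseq n (A B : {set 'I_n}) :
  A \subset B -> subseq (elems A) (elems B).
Proof.
move=> /subsetP sAB; apply: map_subseq.
(* Both enumerations filter the same listing of ['I_n], so filtering that of [B] by [A] gives that
   of [A]. *)
suff -> : enum A = [seq x <- enum B | x \in A] by exact: filter_subseq.
rewrite /enum_mem -filter_predI; apply: eq_filter => x /=.
by apply/idP/andP => [xA | []//]; split=> //; apply: sAB.
Qed.

Lemma subset_nth_elem_leq n (A B : {set 'I_n}) (i : nat) :
  A \subset B -> i < #|A| -> nth_elem B i <= nth_elem A i.
Proof.
move=> sAB lt_i; apply: subseq_sorted_nth_leq; first exact: sorted_elems.
  exact: elems_subseq.
by rewrite size_elems.
Qed.

Lemma superset_set_prec {n} {A A' G : {set 'I_n}} :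
  set_le A' G -> A' \subset A -> set_prec A G.
Proof.
move=> /andP[/eqP cardA' /forallP leA'G] sA'A; rewrite /set_prec.
rewrite -{1}cardA' subset_leq_card //=; apply/forallP => i.
by apply: leq_trans (leA'G i); apply: subset_nth_elem_leq; rewrite // cardA'.
Qed.

Definition initial_segment {n} (A : {set 'I_n}) (r : nat) : {set 'I_n} :=
  [set x in A | val x \in take r (elems A)].

(** Strictly increasing sequences with the same members coincide, so only membership has to be
    compared. *)
Lemma elems_initial_segment n (A : {set 'I_n}) (r : nat) :
  elems (initial_segment A r) = take r (elems A).
Proof.
apply: (irr_sorted_eq ltn_trans ltnn); first exact: sorted_elems.
  exact/take_sorted/sorted_elems.
move=> m; apply/mapP/idP => [[x] | m_take].
  by rewrite mem_enum inE => /andP[_ x_take] ->.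
have /mapP[x xA m_x] := mem_take m_take; exists x => //.
by move: xA; rewrite !mem_enum inE => ->; rewrite -m_x.
Qed.

Lemma set_le_initial_segment n (A G : {set 'I_n}) :
  set_prec A G -> set_le (initial_segment A #|G|) G.
Proof.
move=> /andP[leGA /forallP leAG]; apply/andP; split.
  by rewrite -size_elems elems_initial_segment size_takel ?size_elems.
apply/forallP => i.
by rewrite /nth_elem elems_initial_segment nth_take //; apply: leAG.
Qed.

(** Adjoin to [A] any [k - #|A|] elements of [B :\: A]. *)
Lemma exists_set_between (T : finType) (A B : {set T}) (k : nat) :
  A \subset B -> #|A| <= k <= #|B| ->
  exists C : {set T}, [/\ A \subset C, C \subset B & #|C| = k].
Proof.
move=> sAB /andP[leAk lekB].
have : k - #|A| <= #|B :\: A| by rewrite cardsDS // leq_sub2r.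
case/card_geqP => s [s_uniq s_size s_sub]; exists (A :|: [set x in s]).
split; first exact: subsetUl.
  by rewrite subUset sAB; apply/subsetP => x; rewrite inE => /s_sub /setDP[].
rewrite cardsU disjoint_setI0 ?cards0 ?subn0.
  by rewrite cardsE (card_uniqP s_uniq) s_size subnKC.
rewrite disjoint_sym disjoint_subset; apply/subsetP => x.
by rewrite !inE => /s_sub /setDP[].
Qed.

(** Enlarge [A] inside the complement of [B], then [B] inside the complement of the resulting [C].
    There is room both times: a set of size at most [k] has a complement of size at least [k]. *)
Lemma disjoint_extension (T : finType) (A B : {set T}) (k : nat) :
  2 * k <= #|T| -> #|A| <= k -> #|B| <= k -> A :&: B = set0 ->
  exists C D : {set T},
    [/\ A \subset C, B \subset D, #|C| = k, #|D| = k & C :&: D = set0].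
Proof.
rewrite mul2n -addnn => le2k leA leB /eqP; rewrite setI_eq0 => dAB.
have leC (E : {set T}) : #|E| <= k -> k <= #|~: E|.
  by move=> leE; rewrite cardsCs setCK leq_subRL ?(leq_trans leE) //
    ?(leq_trans _ le2k) ?leq_addr ?leq_add2r.
have [||C [sAC sCB cardC]] := @exists_set_between T A (~: B) k.
- by rewrite -disjoints_subset.
- by rewrite leA leC.
have [||D [sBD sDC cardD]] := @exists_set_between T B (~: C) k.
- by rewrite -disjoints_subset disjoint_sym disjoints_subset.
- by rewrite leB leC ?cardC.
exists C, D; split=> //; apply/eqP.
by rewrite setI_eq0 disjoint_sym disjoints_subset.
Qed.

Theorem theorem1p1 (n k : nat) (n_gt0 : 0 < n) (k_gt0 : 0 < k)
    (k_ge2 : 4 <= 2 * k) (k_le : 2 * k <= n) (G : {set {set 'I_n}})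
    (G_nonempty : forall A : {set 'I_n}, A \in G -> A != set0)
    (G_size : forall A : {set 'I_n}, A \in G -> #|A| <= k) :
  intersecting (generated_family k G) <-> strongly_intersecting G.
Proof.
split=> [/forall_inP intF | /forall_inP siG].
  apply/forall_inP => X XG; apply/forall_inP => Y YG.
  apply/forallP => X'; apply/forallP => Y'; apply/implyP => leX.
  apply/implyP => leY; apply/negP => /eqP dXY.
  (* Disjoint [X'] and [Y'] would extend to disjoint members of the generated family. *)
  have [||||A [B [sXA sYB cardA cardB dAB]]] := @disjoint_extension _ X' Y' k.
  - by rewrite card_ord.
  - by case/andP: leX => /eqP-> _; apply: G_size.
  - by case/andP: leY => /eqP-> _; apply: G_size.
  - exact: dXY.
  have AF : A \in generated_family k G.
    rewrite inE cardA eqxx; apply/exists_inP; exists X => //.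
    exact: superset_set_prec leX sXA.
  have BF : B \in generated_family k G.
    rewrite inE cardB eqxx; apply/exists_inP; exists Y => //.
    exact: superset_set_prec leY sYB.
  by have /forall_inP/(_ B BF) := intF A AF; rewrite dAB eqxx.
apply/forall_inP => A; rewrite inE => /andP[_ /exists_inP[X XG leAX]].
apply/forall_inP => B; rewrite inE => /andP[_ /exists_inP[Y YG leBY]].
(* The initial segments are the witnesses below [X] and [Y]; a point they share lies in both [A] and
   [B]. *)
have /forall_inP/(_ Y YG)/forallP/(_ (initial_segment A #|X|)) := siG X XG.
move=> /forallP/(_ (initial_segment B #|Y|)).
rewrite !set_le_initial_segment //= => /set0Pn[x].
rewrite !inE => /andP[/andP[xA _] /andP[xB _]].
by apply/set0Pn; exists x; rewrite inE xA.
Qed.
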